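(* Let $\nu\in\mathbb{N}$, $\nu\ge 1$, let $\alpha=1/\nu$, and let $p=\omega_0e^{\mathrm{j}\varphi}\in\mathbb{C}$ with $\omega_0>0$, $\varphi=\arg(p)$ and $\operatorname{Re}(p)<0$ (equivalently $|\arg(p)|>\frac{\pi}{2}$), and let $\bar p$ be its complex conjugate. Then all $\nu$-th roots of $p$ and of $\bar p$, that is, all $\lambda\in\mathbb{C}$ with $\lambda^\nu=p$ or $\lambda^\nu=\bar p$, are located in the stable region $\mathbb{C}_\alpha=\{w\in\mathbb{C} : |\arg(w)|>\alpha\frac{\pi}{2}\}$.
   Context: $\mathrm{j}$ is the imaginary unit and $\arg$ is the principal argument, with values in $(-\pi,\pi]$. *)

(* Defs.v *)
(* Stdlib reals, with the complex numbers C of Coquelicot. *)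
From Stdlib Require Export Reals.
From Coquelicot Require Export Complex.
From Stdlib Require Import Lra.
Open Scope R_scope.

Definition Cexp (z : C) : C :=
  (RtoC (exp (Re z)) * (cos (Im z), sin (Im z)))%C.

(* Principal argument, with values in (-PI, PI].  The polar-form equation
   determines it for z <> 0 (see Carg_spec); at 0 it is set to 0, so that 0 lies
   in no region of the form {|arg w| > c} with c >= 0. *)
Definition Carg (z : C) : R :=
  if Ceq_dec z (RtoC 0) then 0
  else if Rle_dec 0 (Im z) then acos (Re z / Cmod z)
  else - acos (Re z / Cmod z).

Lemma Carg_spec (z : C) : z <> RtoC 0 ->
  - PI < Carg z <= PI /\ z = (RtoC (Cmod z) * Cexp (Ci * RtoC (Carg z)))%C.
Proof.
intros Hz.
assert (Hm : 0 < Cmod z) by now apply Cmod_gt_0.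
set (c := Re z / Cmod z).
assert (Hre : Re z = Cmod z * c) by (unfold c; field; lra).
assert (Hsq := Cmod2_alt z).
assert (Hc : -1 <= c <= 1).
{ assert (Hle := re_le_Cmod z).
  apply Rcomplements.Rabs_le_between in Hle. nra. }
assert (Him : Rabs (Im z) = Cmod z * sqrt (1 - Rsqr c)).
{ rewrite <- (sqrt_Rsqr (Cmod z)) at 1 by lra.
  rewrite <- sqrt_mult_alt by apply Rle_0_sqr.
  rewrite <- sqrt_Rsqr_abs. f_equal. unfold Rsqr. nra. }
assert (Hb := acos_bound c).
assert (Hcos := cos_acos c Hc).
assert (Hsin := sin_acos c Hc).
assert (Hpol : forall t,
  Re z = Cmod z * cos t -> Im z = Cmod z * sin t ->
  z = (RtoC (Cmod z) * Cexp (Ci * RtoC t))%C).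
{ intros t H1 H2.
  assert (He : Cexp (Ci * RtoC t) = (cos t, sin t)).
  { unfold Cexp. rewrite re_scal_r, im_scal_r. simpl.
    rewrite Rmult_0_l, Rmult_1_l, exp_0. apply Cmult_1_l. }
  rewrite He. apply injective_projections; unfold Cmult; simpl.
  - change (fst z) with (Re z). lra.
  - change (snd z) with (Im z). lra. }
assert (HPI := PI_RGT_0).
unfold Carg. destruct (Ceq_dec z (RtoC 0)) as [E | _]; [contradiction|].
fold c. destruct (Rle_dec 0 (Im z)) as [H | H].
- split; [lra|]. apply Hpol.
  + rewrite Hcos. exact Hre.
  + rewrite Hsin, <- Him. symmetry. now apply Rabs_pos_eq.
- assert (Hlt : acos c <> PI).
  { intros E. rewrite E, sin_PI in Hsin. rewrite <- Hsin in Him.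
    rewrite Rabs_left in Him by lra. lra. }
  split; [lra|]. apply Hpol.
  + rewrite cos_neg, Hcos. exact Hre.
  + rewrite sin_neg, Hsin.
    rewrite Rabs_left in Him by lra. lra.
Qed.

Definition stable_region (alpha : R) (w : C) : Prop :=
  Rabs (Carg w) > alpha * (PI / 2).

(* Main.v *)
Require Import Defs.
From Stdlib Require Import Lra Lia.

(** By de Moivre, [Re (w ^ n) = Cmod w ^ n * cos (n * Carg w)], which is
    nonnegative as soon as [n * Rabs (Carg w) <= PI / 2]; but [p] and its
    conjugate both have negative real part. *)

(** The proof is by contraposition: a root outside the region has
    [nu * Rabs (Carg lambda) <= PI / 2], so [Re_pow_ge0] contradicts [Re p < 0]. Only the real part
    of the power matters, so [p] and its conjugate need no separate treatment and [Carg] of a power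
    is never computed. *)

Lemma Cexp_imag (t : R) : Cexp (Ci * RtoC t) = (cos t, sin t).
Proof.
unfold Cexp. rewrite re_scal_r, im_scal_r. simpl.
rewrite Rmult_0_l, Rmult_1_l, exp_0. apply Cmult_1_l.
Qed.

Lemma Cpow_polar (r t : R) (n : nat) :
  ((RtoC r * (cos t, sin t)) ^ n)%C
  = (RtoC (r ^ n) * (cos (INR n * t), sin (INR n * t)))%C.
Proof.
induction n as [|n IH].
- simpl. rewrite Rmult_0_l, cos_0, sin_0.
  symmetry. apply Cmult_1_l.
- change ((RtoC r * (cos t, sin t)) ^ S n)%C
    with ((RtoC r * (cos t, sin t)) * (RtoC r * (cos t, sin t)) ^ n)%C.
  rewrite IH, S_INR, Rmult_plus_distr_r, Rmult_1_l, cos_plus, sin_plus.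
  apply injective_projections; simpl; ring.
Qed.

Lemma Re_pow_ge0 (n : nat) (w : C) :
  w <> RtoC 0 -> INR n * Rabs (Carg w) <= PI / 2 -> 0 <= Re (w ^ n)%C.
Proof.
intros Hw Harg.
destruct (Carg_spec w Hw) as [_ Hpol].
rewrite Cexp_imag in Hpol.
rewrite Hpol, Cpow_polar, re_scal_l.
apply Rmult_le_pos; [apply pow_le, Cmod_ge_0|].
(* Moving [INR n] inside the absolute value places the angle [INR n * Carg w] in [[-PI/2, PI/2]],
   where cosine is nonnegative. *)
rewrite <- (Rabs_pos_eq (INR n)), <- Rabs_mult in Harg by apply pos_INR.
apply Rcomplements.Rabs_le_between in Harg.
apply cos_ge_0; lra.
Qed.

Theorem mainTheorem2 (nu : nat) (alpha : R) (p : C) (omega0 phi : R)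
  (Hnu : (1 <= nu)%nat)
  (Halpha : alpha = 1 / INR nu)
  (Homega0 : 0 < omega0)
  (Hp : p = (RtoC omega0 * Cexp (Ci * RtoC phi))%C)
  (Hphi : phi = Carg p)
  (HRe : Re p < 0) :
  forall lambda : C,
    (lambda ^ nu)%C = p \/ (lambda ^ nu)%C = Cconj p ->
    stable_region alpha lambda.
Proof.
intros lambda Hroot.
assert (Hneg : Re (lambda ^ nu)%C < 0) by (destruct Hroot as [-> | ->]; exact HRe).
assert (Hn : 0 < INR nu) by (apply lt_0_INR; lia).
(* The polar form needs a nonzero root; as [nu >= 1], a zero root would give a power with real part
   0. *)
assert (H0 : lambda <> RtoC 0).
{ intros ->. destruct nu as [|n]; [lia|].
  change (RtoC 0 ^ S n)%C with (RtoC 0 * RtoC 0 ^ n)%C in Hneg.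
  rewrite Cmult_0_l in Hneg. simpl in Hneg. lra. }
unfold stable_region. apply Rnot_le_gt. intros Hle.
apply (Rlt_not_le _ _ Hneg), Re_pow_ge0; [exact H0|].
apply (Rmult_le_compat_l (INR nu)) in Hle; [|lra].
replace (PI / 2) with (INR nu * (alpha * (PI / 2))); [exact Hle|].
rewrite Halpha. field. lra.
Qed.
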